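(* Let $T$ be an ergodic measure preserving automorphism of a standard probability space $(X,\mathcal{S},\mu)$, let $d\geq1$, and let $f\colon X\to\mathbb{R}^d$ be a Borel map. Suppose that either the distributions (under $\mu$) of the random variables $\mathbf{f}(n,\cdot)/n^{1/d}$, $n\geq1$, are uniformly tight, or there exist $\varepsilon,K>0$ such that $\mu(\{x\in X:\|\mathbf{f}(n,x)/n^{1/d}\|\leq K\})>\varepsilon$ for every $n\geq1$. Then the map $\tilde f\colon X\times X\to\mathbb{R}^d$, $\tilde f(x,y)=f(x)-f(y)$, is recurrent with respect to the automorphism $S=T\times T$ of $(X\times X,\mathcal{S}\otimes\mathcal{S},\mu\times\mu)$.
   Context: For a measure preserving automorphism $T$ of a probability space $(X,\mathcal{S},\mu)$ and a Borel map $f\colon X\to\mathbb{R}^d$, the cocycle $\mathbf{f}\colon\mathbb{Z}\times X\to\mathbb{R}^d$ is defined by $\mathbf{f}(n,x)=f(T^{n-1}x)+\dots+f(x)$ for $n>0$, $\mathbf{f}(0,x)=0$, and $\mathbf{f}(n,x)=-\mathbf{f}(-n,T^nx)$ for $n<0$. The function $f$ is called recurrent if $\liminf_{n\to\infty}\|\mathbf{f}(n,x)\|=0$ for $\mu$-a.e. $x\in X$; here $\|\cdot\|$ denotes the maximum norm on $\mathbb{R}^d$ (recurrence does not depend on the choice of norm). For $\tilde f$ and $S=T\times T$ the cocycle $\tilde{\mathbf{f}}$ is defined by the same formula with $S,\tilde f$ in place of $T,f$, and recurrence of $\tilde f$ means $\liminf_{n\to\infty}\|\tilde{\mathbf{f}}(n,(x,y))\|=0$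 for $(\mu\times\mu)$-a.e. $(x,y)$. *)

(* Defs.v *)
From HB Require Import structures.
From mathcomp Require Import all_boot all_order all_algebra.
From mathcomp Require Import all_classical all_reals all_analysis.
Set Implicit Arguments. Unset Strict Implicit. Unset Printing Implicit Defensive.
Import Order.TTheory GRing.Theory Num.Theory.
Import numFieldNormedType.Exports.
Local Open Scope classical_set_scope.
Local Open Scope ring_scope.

(* Standard Borel space: measurably isomorphic to a Borel subset of R
   (equivalently, by Kuratowski, to a Borel subset of a Polish space). *)
Definition standard_borel (R : realType) (d : measure_display)
    (X : measurableType d) : Prop :=
  exists (B : set R) (phi : X -> R) (psi : R -> X),
    measurable B /\ measurable_fun setT phi /\ measurable_fun B psi /\
    (forall x, B (phi x)) /\ (forall x, psi (phi x) = x) /\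
    (forall r, B r -> phi (psi r) = r).

Definition mp_automorphism (R : realType) (d : measure_display)
    (X : measurableType d) (mu : set X -> \bar R) (T : X -> X) : Prop :=
  exists Tinv : X -> X,
    cancel T Tinv /\ cancel Tinv T /\
    measurable_fun setT T /\ measurable_fun setT Tinv /\
    (forall A, measurable A -> mu (T @^-1` A) = mu A).

Definition ergodic (R : realType) (d : measure_display)
    (X : measurableType d) (mu : set X -> \bar R) (T : X -> X) : Prop :=
  forall A, measurable A -> T @^-1` A = A -> (mu A = 0%E \/ mu A = 1%E).

(* Borel map X -> R^d (R^d = row vectors, Borel sigma-algebra = product one) *)
Definition borel_vec_map (R : realType) (d : measure_display)
    (X : measurableType d) (k : nat) (f : X -> 'rV[R]_k) : Prop :=
  forall i : 'I_k, measurable_fun setT (fun x => f x ord0 i).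

Definition cocycle (X : Type) (R : realType) (k : nat) (T : X -> X)
    (f : X -> 'rV[R]_k) (n : nat) (x : X) : 'rV[R]_k :=
  \sum_(i < n) f (iter i T x).

(* recurrence: liminf_n ||f(n,x)|| = 0 mu-a.e.; `|v| on 'rV is the max norm *)
Definition recurrent (R : realType) (d : measure_display)
    (X : measurableType d) (mu : set X -> \bar R) (k : nat)
    (T : X -> X) (f : X -> 'rV[R]_k) : Prop :=
  {ae mu, forall x, limn_einf (fun n => (`| cocycle T f n x |)%:E) = 0%E}.

Definition normalized_cocycle (X : Type) (R : realType) (k : nat) (T : X -> X)
    (f : X -> 'rV[R]_k) (n : nat) (x : X) : 'rV[R]_k :=
  (n%:R `^ (k%:R)^-1)^-1 *: cocycle T f n x.

Definition unif_tight (R : realType) (d : measure_display)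
    (X : measurableType d) (mu : set X -> \bar R) (k : nat)
    (T : X -> X) (f : X -> 'rV[R]_k) : Prop :=
  forall eps : R, 0 < eps -> exists C : set 'rV[R]_k, compact C /\
    forall n : nat, (0 < n)%N ->
      (mu [set x | ~ C (normalized_cocycle T f n x)] <= eps%:E)%E.

Definition swap_pair_map (X : Type) (T : X -> X) : X * X -> X * X :=
  fun z => (T z.1, T z.2).

Definition diff_map (X : Type) (R : realType) (k : nat) (f : X -> 'rV[R]_k)
  : X * X -> 'rV[R]_k := fun z => f z.1 - f z.2.

(* Main.v *)
Require Import Defs.
From HB Require Import structures.
From mathcomp Require Import all_boot all_order all_algebra.
From mathcomp Require Import finmap all_classical all_reals all_analysis.
From mathcomp Require Import measurable_realfun zify ring lra.
Set Implicit Arguments. Unset Strict Implicit. Unset Printing Implicit Defensive.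
Import Order.TTheory GRing.Theory Num.Theory.
Import numFieldNormedType.Exports.
Local Open Scope classical_set_scope.
Local Open Scope ring_scope.

(** Write [S] for [T x T], [g] for the difference map and [g_n] for its cocycle.
    Suppose that [`|g_n|] is bounded away from [0] for large [n] on a set [B] of
    positive measure.  In every ball the visits of an orbit to [B] are then
    bounded in number by the volume, and a Vitali covering argument along orbits
    gives a maximal inequality, which shows that the upper spatial density
      limsup_r r^-d #{n >= 0 : |g_n| <= r}
    is finite on a set of positive measure.  The same maximal inequality shows
    that adding a coboundary does not increase this density.  Since [g o (id x T)]
    and [g o (T x id)] are cohomologous to [g], the sets where the density is at
    most [lam] are almost invariant under both maps, so by ergodicity of [T] the
    density is bounded by one constant [lam] almost everywhere.

    On the other hand, by the pigeonhole principle two independent points lie in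
    a common cube of side [r] at time [t >= r^d] with probability at least
    [c r^d / t].  Summing over [r^d <= t < 2^J r^d] yields on average at least
    of order [J r^d] visits to the ball of radius [r]; for [J] large compared to
    [lam / c] and then [r] large this contradicts the bound on the density. *)

(** * Covering *)

Lemma leq_sum_shift (F : nat -> nat) (m N M : nat) : (m <= N)%N ->
  (\sum_(n < M) F (m + n)%N <= \sum_(n < N + M) F n)%N.
Proof.
move=> mN.
rewrite -(big_mkord predT (fun n => F (m + n)%N)) -(big_mkord predT F).
rewrite (@big_cat_nat _ _ _ m 0 (N + M)) //=; last exact: leq_trans mN (leq_addr _ _).
rewrite (@big_cat_nat _ _ _ (m + M) m (N + M)) ?leq_addr ?leq_add2r //=.
rewrite -{2}[m]add0n (big_addn 0 (m + M) m) addKn.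
under [X in (_ <= _ + (X + _))%N]eq_bigr do rewrite addnC.
rewrite addnCA; exact: leq_addr.
Qed.

(* Vitali covering: discard, around a bad point of largest radius, all bad
   points whose balls may meet its ball. *)
Lemma vitali_count (R : realType) (V : normedZmodType R) (p : nat -> V)
    (N M L d be q : nat) (Bt Qt : pred nat) (rad : 'I_N -> nat)
    (A : {set 'I_N}) :
  (forall v r, (0 < r)%N ->
    (\sum_(n < N) (Bt n && (`|p n - v| <= r%:R)%R) <= L * r ^ d)%N) ->
  (forall m, m \in A -> [/\ Bt m, (0 < rad m)%N &
    (be * rad m ^ d <= q * \sum_(n < M)
       (Qt (m + n)%N && (`|p (m + n)%N - p m| <= (rad m)%:R)%R))%N]) ->
  (be * #|A| <= L * 2 ^ d * q * \sum_(n < N + M) Qt n)%N.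
Proof.
move=> sparse badA.
pose near (m : 'I_N) n := `|p n - p m| <= (rad m)%:R.
pose cov (A' : {set 'I_N}) n := [exists m in A', near m n].
(* The strengthened claim counts only the visits to [Qt] inside the balls of [A'], so that
   contributions of disjoint balls can be added during the induction. *)
suff H : forall k (A' : {set 'I_N}), (#|A'| <= k)%N -> A' \subset A ->
    (be * #|A'| <= L * 2 ^ d * q * \sum_(n < N + M) (Qt n && cov A' n))%N.
  apply: leq_trans (H _ A (leqnn _) (subxx _)) _.
  rewrite leq_mul2l; apply/orP; right; apply: leq_sum => n _.
  by case: (Qt n); case: (cov A n).
elim=> [|k IH] A' cA' sA'.
  by move: cA'; rewrite leqn0 => /eqP ->; rewrite muln0.
have [->|[m mA']] := set_0Vmem A'; first by rewrite cards0 muln0.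
pose m0 := [arg max_(m > m in A') rad m]%N.
have [m0A' m0max] : m0 \in A' /\ forall i, i \in A' -> (rad i <= rad m0)%N.
  by rewrite /m0; case: arg_maxnP.
have [_ r0 hm0] := badA _ (fintype.subsetP sA' _ m0A').
pose far := [set m in A' | ~~ (`|p m - p m0| <= (2 * rad m0)%N%:R)].
have m0far : m0 \notin far by rewrite !inE subrr normr0 ler0n m0A'.
have fA' : far \subset A' by apply/fintype.subsetP => i; rewrite inE => /andP[].
have cfar : (#|far| <= k)%N.
  rewrite -ltnS; apply: leq_trans cA'; apply: proper_card.
  by apply/properP; split => //; exists m0.
have IHfar := IH far cfar (fintype.subset_trans fA' sA').
(* The discarded points are [Bt]-visits in the ball of radius [2 * rad m0] about [p m0], so
   sparseness bounds their number. *)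
have cA : (#|A'| <= #|far| + L * (2 * rad m0) ^ d)%N.
  rewrite -(cardsID far A') (finset.setIidPr fA') leq_add2l.
  apply: leq_trans (sparse (p m0) (2 * rad m0)%N _); last by rewrite muln_gt0.
  rewrite -sum1_card big_mkcond /=; apply: leq_sum => i _.
  rewrite !inE; case iA': (i \in A'); last by rewrite andbF.
  have [-> _ _] := badA _ (fintype.subsetP sA' _ iA').
  by rewrite andbT /= negbK; case: (_ <= _).
(* No time is counted twice: centres more than [2 * rad m0] apart with radii at most [rad m0] have
   disjoint balls. *)
have ccov : (\sum_(n < N + M) (Qt n && cov far n) +
    \sum_(n < M) (Qt (m0 + n)%N && near m0 (m0 + n)%N)
    <= \sum_(n < N + M) (Qt n && cov A' n))%N.
  apply: (@leq_trans (\sum_(n < N + M) (Qt n && cov far n) +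
                      \sum_(n < N + M) (Qt n && near m0 n))%N).
    rewrite leq_add2l; apply: (leq_sum_shift (fun n => (Qt n && near m0 n : nat))).
    exact: ltnW (ltn_ord _).
  rewrite -big_split /=; apply: leq_sum => n _.
  case: (Qt n) => //=.
  have [nm0|nm0] := boolP (near m0 n); last first.
    rewrite addn0; have [/exists_inP[m' m'f nm']|//] := boolP (cov far n).
    by have -> : cov A' n; [apply/exists_inP; exists m' => //; exact: (fintype.subsetP fA')|].
  have -> : cov A' n by apply/exists_inP; exists m0.
  have [/exists_inP[m' m'f nm']|//] := boolP (cov far n).
  move: (m'f); rewrite inE => /andP[m'A' /negP[]].
  rewrite (le_trans (ler_distD (p n) _ _)) // mul2n -addnn natrD lerD //.
  rewrite distrC (le_trans nm') // ler_nat; exact: m0max.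
apply: (@leq_trans (be * (#|far| + L * (2 * rad m0) ^ d)))%N.
  by rewrite leq_mul2l cA orbT.
apply: leq_trans (leq_mul (leqnn _) ccov).
rewrite !mulnDr leq_add //.
rewrite expnMn.
apply: (@leq_trans (L * 2 ^ d * (be * rad m0 ^ d)))%N; first by nia.
by rewrite -[leqRHS]mulnA leq_mul2l hm0 orbT.
Qed.

(** * Measurability and probability *)

Section measurable_sets.
Context d (Z : measurableType d).
Implicit Types (P : nat -> Z -> Prop).

Lemma measurable_forall P : (forall n, measurable [set z | P n z]) ->
  measurable [set z | forall n, P n z].
Proof.
move=> mP; rewrite (_ : mkset _ = \bigcap_n [set z | P n z]).
  exact: bigcapT_measurable.
by apply/seteqP; split=> z /= h n; [move=> _; exact: h|exact: h].
Qed.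

Lemma measurable_exists P : (forall n, measurable [set z | P n z]) ->
  measurable [set z | exists n, P n z].
Proof.
move=> mP; rewrite (_ : mkset _ = \bigcup_n [set z | P n z]).
  exact: bigcupT_measurable.
by apply/seteqP; split=> z /= [n]; [exists n|exists n].
Qed.

Lemma measurable_imply (A : Prop) (B : Z -> Prop) :
  (A -> measurable [set z | B z]) -> measurable [set z | A -> B z].
Proof.
move=> mB; have [a|na] := pselect A.
  by rewrite (_ : mkset _ = [set z | B z]); [exact: mB|apply/seteqP; split=> z /=; auto].
by rewrite (_ : mkset _ = setT) //; apply/seteqP; split=> z /=.
Qed.

Lemma measurable_and (A B : Z -> Prop) : measurable [set z | A z] ->
  measurable [set z | B z] -> measurable [set z | A z /\ B z].
Proof. exact: measurableI. Qed.

Lemma measurable_const_and (A : Prop) (B : Z -> Prop) :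
  (A -> measurable [set z | B z]) -> measurable [set z | A /\ B z].
Proof.
move=> mB; have [a|na] := pselect A.
  rewrite (_ : mkset _ = [set z | B z]); first exact: mB.
  by apply/seteqP; split=> z /= => [[]|].
by rewrite (_ : mkset _ = set0) //; apply/seteqP; split=> z /= [].
Qed.

Lemma measurable_preim d' (Y : measurableType d') (S : Z -> Y) (A : set Y) :
  measurable_fun setT S -> measurable A -> measurable (S @^-1` A).
Proof. by move=> mS mA; rewrite -[X in measurable X]setTI; exact: mS. Qed.

Lemma measurable_iter (S : Z -> Z) n : measurable_fun setT S ->
  measurable_fun setT (iter n S).
Proof.
move=> mS; elim: n => [|n IH] /=; first exact: measurable_id.
exact: measurableT_comp.
Qed.

End measurable_sets.

(** Integration of the pointwise inequality between sums of indicators. Every counting argument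
    along orbits passes to measures in this form. *)
Lemma sum_measure_le (R : realType) d (Z : measurableType d)
    (P : probability Z R) (I J : finType) (A : I -> set Z) (B : J -> set Z)
    (a b : nat) :
  (forall i, measurable (A i)) -> (forall j, measurable (B j)) ->
  (forall z, (a * \sum_i (z \in A i) <= b * \sum_j (z \in B j))%N) ->
  a%:R * \sum_i fine (P (A i)) <= b%:R * \sum_j fine (P (B j)).
Proof.
move=> mA mB AB.
have sumE (K : finType) (c : nat) (C : K -> set Z) :
    (forall k, measurable (C k)) ->
    (\int[P]_z (c%:R * \sum_k \1_(C k) z)%:E)%E
    = (c%:R * \sum_k fine (P (C k)))%:E.
  move=> mC.
  under eq_integral do rewrite EFinM -sumEFin.
  rewrite ge0_integralZl //; last 2 first.
  - by apply: emeasurable_sum => k; apply/measurable_EFinP; exact: measurable_indic.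
  - by move=> z _; apply: sume_ge0 => k _; rewrite lee_fin indicE ler0n.
  rewrite ge0_integral_sum //; last first.
    by move=> k; apply/measurable_EFinP; exact: measurable_indic.
  rewrite EFinM -sumEFin; congr (_ * _)%E; apply: eq_bigr => k _.
  by rewrite integral_indic // setIT fineK // fin_num_measure.
have mE (K : finType) (c : nat) (C : K -> set Z) :
    (forall k, measurable (C k)) ->
    measurable_fun setT (fun z => (c%:R * \sum_k \1_(C k) z)%:E : \bar R).
  move=> mC; apply/measurable_EFinP; apply: measurable_funM => //.
  by apply: measurable_sum => k; exact: measurable_indic.
have E0 (K : finType) (c : nat) (C : K -> set Z) z :
    (0 <= (c%:R * \sum_k \1_(C k) z : R)%:E)%E.
  by rewrite lee_fin mulr_ge0 // sumr_ge0 // => k _; rewrite indicE ler0n.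
rewrite -lee_fin -!sumE //; apply: ge0_le_integral => //.
- exact: mE.
- exact: mE.
- move=> z _; rewrite lee_fin; under eq_bigr do rewrite indicE.
  under [in leRHS]eq_bigr do rewrite indicE.
  by rewrite -!natr_sum -!natrM ler_nat.
Qed.

Section probability_extra.
Context (R : realType) d (Z : measurableType d) (P : probability Z R).
Implicit Types A B C : set Z.

Lemma le_fine_prob A B : measurable A -> measurable B -> A `<=` B ->
  fine (P A) <= fine (P B).
Proof.
move=> mA mB AB; rewrite fine_le ?fin_num_measure //.
by apply: le_measure => //; rewrite inE.
Qed.

Lemma fine_prob_ge0 A : 0 <= fine (P A).
Proof. exact: fine_ge0. Qed.

Lemma fine_probC A : measurable A -> fine (P (~` A)) = 1 - fine (P A).
Proof. by move=> mA; rewrite probability_setC // fineB ?fin_num_measure. Qed.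

Lemma fine_prob_le_setU A B C : measurable A -> measurable B -> measurable C ->
  C `<=` A `|` B -> fine (P C) <= fine (P A) + fine (P B).
Proof.
move=> mA mB mC CAB; rewrite -fineD ?fin_num_measure //.
apply: fine_le; rewrite ?fin_numD ?fin_num_measure //.
apply: (@le_trans _ _ (P (A `|` B))); last exact: measureU2.
by apply: le_measure; rewrite ?inE //; exact: measurableU.
Qed.

Lemma prob0_fine A : measurable A -> fine (P A) = 0 -> P A = 0%E.
Proof. by move=> mA A0; rewrite -[LHS]fineK ?fin_num_measure // A0. Qed.

Lemma fine_prob_bigcup_le (F : nat -> set Z) (x : R) :
  (forall n, measurable (F n)) -> nondecreasing_seq F ->
  (forall n, fine (P (F n)) <= x) -> fine (P (\bigcup_n F n)) <= x.
Proof.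
move=> mF ndF Fx.
have mU : measurable (\bigcup_n F n) by exact: bigcupT_measurable.
have cF := nondecreasing_cvg_mu (mu := P) mF mU ndF.
rewrite -lee_fin fineK ?fin_num_measure // -(cvg_lim _ cF) //.
apply: lime_le; first by apply/cvg_ex; exists (P (\bigcup_n F n)).
by apply: nearW => n /=; rewrite -[leLHS]fineK ?fin_num_measure // lee_fin.
Qed.

Lemma fine_prob_bigcup_approx (F : nat -> set Z) (e : R) :
  (forall n, measurable (F n)) -> nondecreasing_seq F -> 0 < e ->
  exists n, fine (P (\bigcup_n F n)) - e < fine (P (F n)).
Proof.
move=> mF ndF e0; apply: contrapT => /forallNP h.
have /(fine_prob_bigcup_le mF ndF) :
    forall n, fine (P (F n)) <= fine (P (\bigcup_n F n)) - e.
  by move=> n; rewrite leNgt; exact/negP/h.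
by rewrite leNgt gtrBl e0.
Qed.

Lemma measure_preserving_iter (S : Z -> Z) n A : measurable_fun setT S ->
  (forall A, measurable A -> P (S @^-1` A) = P A) ->
  measurable A -> P (iter n S @^-1` A) = P A.
Proof.
move=> mS pS mA; elim: n => [//|n IH].
rewrite -{}IH -[RHS]pS; last exact: measurable_preim (measurable_iter _ mS) mA.
by congr (P _); apply/funext => z; rewrite /preimage /= -iterSr.
Qed.

End probability_extra.

(** * Cocycle identities and vector-valued Borel maps *)

Section cocycle_theory.
Context (R : realType) (k : nat) (X : Type).
Implicit Types (S : X -> X) (g : X -> 'rV[R]_k).

Lemma cocycle_add S g m n z :
  cocycle S g (m + n) z = cocycle S g m z + cocycle S g n (iter m S z).
Proof.
rewrite /cocycle big_split_ord /=; congr (_ + _).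
by apply: eq_bigr => i _; rewrite addnC iterD.
Qed.

(** Splitting time [n + 1] as [1 + n] and as [n + 1] gives the same sum. Hence [g] composed with [S]
    is cohomologous to [g], with [g] itself as transfer function. *)
Lemma cocycle_shift S g n z :
  cocycle S g n (S z) = cocycle S g n z + g (iter n S z) - g z.
Proof.
have e1 := cocycle_add S g 1 n z; have e2 := cocycle_add S g n 1 z.
rewrite addnC in e2; rewrite {}e1 in e2.
move: e2; rewrite /cocycle !big_ord_recl !big_ord0 /= !addr0 => e2.
by rewrite -e2 addrC addKr.
Qed.

End cocycle_theory.

Section borel_vec.
Context (R : realType) d (Z : measurableType d) (k : nat).
Implicit Types (S : Z -> Z) (g : Z -> 'rV[R]_k).

Lemma rV_norm_le (v : 'rV[R]_k) (x : R) : 0 <= x ->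
  (`|v| <= x) <-> (forall i, `|v ord0 i| <= x).
Proof.
move=> x0; rewrite /Num.norm /= mx_normrE; split=> [/bigmax_leP[_ h] i|h].
  exact: (h (ord0, i)).
by apply/bigmax_leP; split => // -[i j] _ /=; rewrite ord1; exact: h.
Qed.

Lemma measurable_rV_norm_le g (x : R) : borel_vec_map g ->
  measurable [set z | `|g z| <= x].
Proof.
move=> mg; have [x0|x0] := leP 0 x; last first.
  rewrite (_ : mkset _ = set0) //; apply/seteqP; split=> z //= h.
  by have := le_lt_trans h x0; rewrite ltNge normr_ge0.
rewrite (_ : mkset _ = \bigcap_(i in setT) [set z | `|g z ord0 i| <= x]).
  apply: fin_bigcap_measurable => // i _.
  have : measurable_fun setT (fun z => `|g z ord0 i|) by exact: measurableT_comp.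
  by move=> /measurable_preim-/(_ _ (measurable_itv `]-oo, x])); rewrite preimage_itvNyc.
apply/seteqP; split=> z /=; rewrite rV_norm_le // => h i; [by move=> _; exact: h|exact: (h i I)].
Qed.

Lemma borel_vec_cocycle S g n : measurable_fun setT S -> borel_vec_map g ->
  borel_vec_map (cocycle S g n).
Proof.
move=> mS mg i; rewrite /cocycle.
under eq_fun do rewrite summxE.
apply: measurable_sum => j; apply: (measurableT_comp (mg i)).
exact: measurable_iter.
Qed.

End borel_vec.

(** * The maximal inequality *)

Section orbit_counting.
Context (R : realType) (k : nat).

Definition hits (Z : Type) (S : Z -> Z) (g : Z -> 'rV[R]_k) (Q : set Z)
    (M r : nat) (z : Z) : nat :=
  (\sum_(n < M) ((iter n S z \in Q) && (`|cocycle S g n z| <= r%:R)%R))%N.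

(** The centre [v] is arbitrary because the covering argument uses balls around any point of the
    orbit, not only around the origin. *)
Definition sparse (Z : Type) (S : Z -> Z) (g : Z -> 'rV[R]_k) (B : set Z)
    (L : nat) : Prop :=
  forall z N v r, (0 < r)%N ->
    (\sum_(n < N) ((iter n S z \in B) && (`|cocycle S g n z - v| <= r%:R)%R)
       <= L * r ^ k)%N.

Lemma hits_le_time (Z : Type) (S : Z -> Z) (g : Z -> 'rV[R]_k) (Q : set Z)
    (M M' r : nat) (z : Z) :
  (M <= M')%N -> (hits S g Q M r z <= hits S g Q M' r z)%N.
Proof.
move=> MM'; rewrite /hits -(subnKC MM') big_split_ord /=; exact: leq_addr.
Qed.

Lemma hits_le_radius (Z : Type) (S : Z -> Z) (g : Z -> 'rV[R]_k) (Q : set Z)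
    (M r r' : nat) (z : Z) :
  (r <= r')%N -> (hits S g Q M r z <= hits S g Q M r' z)%N.
Proof.
move=> rr'; apply: leq_sum => n _; case: (_ \in Q) => //=.
have [h|//] := boolP (_ <= r%:R); rewrite (le_trans h) // ler_nat //.
Qed.

Context d (Z : measurableType d).
Variables (P : probability Z R) (S : Z -> Z) (g : Z -> 'rV[R]_k).
Hypothesis mS : measurable_fun setT S.
Hypothesis mg : borel_vec_map g.

Lemma measurable_hits (Q : set Z) (M r : nat) (A : set nat) : measurable Q ->
  measurable [set z | A (hits S g Q M r z)].
Proof.
move=> mQ.
have mN : measurable_fun setT (fun z => (hits S g Q M r z)%:R : R).
  rewrite /hits; under eq_fun do rewrite natr_sum.
  apply: measurable_sum => n.
  pose E := (iter n S @^-1` Q) `&` [set z | `|cocycle S g n z| <= r%:R].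
  rewrite (_ : (fun _ => _) = \1_E); last first.
    apply/funext => z; rewrite indicE; congr (nat_of_bool _)%:R.
    apply/idP/idP => [/andP[/set_mem h1 h2]|/set_mem[h1 h2]].
      by rewrite inE.
    by rewrite mem_set.
  apply: measurable_indic; apply: measurableI.
    exact: measurable_preim (measurable_iter _ mS) mQ.
  exact: measurable_rV_norm_le (borel_vec_cocycle n mS mg).
rewrite (_ : mkset _ = \bigcup_(n in A) [set z | (hits S g Q M r z)%:R = n%:R :> R]).
  apply: bigcup_measurable => n _.
  exact: measurable_preim mN (measurable_set1 _).
apply/seteqP; split=> [z /= Az|z [n An] /= /eqP]; first by exists (hits S g Q M r z).
by rewrite eqr_nat => /eqP ->.
Qed.

Hypothesis pS : forall A, measurable A -> P (S @^-1` A) = P A.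

(** Transference: [vitali_count] is applied to each orbit segment of length [N] and integrated. By
    invariance of [P] both sides become multiples of single measures; first [N], then the time bound
    [M] tends to infinity. *)
Lemma maximal_inequality (B Q : set Z) (L be q : nat) :
  measurable B -> measurable Q -> sparse S g B L ->
  be%:R * fine (P [set z | B z /\ exists r M, (0 < r)%N /\
                           (be * r ^ k <= q * hits S g Q M r z)%N])
  <= (L * 2 ^ k * q)%:R * fine (P Q).
Proof.
move=> mB mQ spB.
pose bad M := [set z | B z /\ exists r, (0 < r)%N /\
                 (be * r ^ k <= q * hits S g Q M r z)%N].
have mbad M : measurable (bad M).
  apply: measurable_and => //; apply: measurable_exists => r.
  apply: measurable_const_and => _.
  exact: (@measurable_hits Q M r [set n | (be * r ^ k <= q * n)%N] mQ).
have ndbad : nondecreasing_seq bad.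
  move=> M M' MM'; apply/subsetPset => z [Bz [r [r0 h]]]; split => //.
  by exists r; split => //; apply: leq_trans h _; rewrite leq_mul2l hits_le_time ?orbT.
set C := (_ * _ * q)%N.
have finite_window N M :
    be%:R * (N%:R * fine (P (bad M))) <= C%:R * ((N + M)%:R * fine (P Q)).
  have -> : N%:R * fine (P (bad M)) =
      \sum_(i < N) fine (P (iter i S @^-1` bad M)).
    under eq_bigr do rewrite measure_preserving_iter //.
    by rewrite sumr_const card_ord mulr_natl.
  have -> : (N + M)%:R * fine (P Q) =
      \sum_(i < N + M) fine (P (iter i S @^-1` Q)).
    under eq_bigr do rewrite measure_preserving_iter //.
    by rewrite sumr_const card_ord mulr_natl.
  apply: sum_measure_le.
  - by move=> i; exact: measurable_preim (measurable_iter _ mS) _.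
  - by move=> i; exact: measurable_preim (measurable_iter _ mS) _.
  move=> z.
  pose A := [set m : 'I_N | iter m S z \in bad M]%SET.
  (* Each bad time gets a radius witnessing its badness; the value [0] elsewhere is a dummy. *)
  have /choice[rad radP] : forall m : 'I_N, exists r, m \in A -> (0 < r)%N /\
      (be * r ^ k <= q * hits S g Q M r (iter m S z))%N.
    move=> m; have [|_] := boolP (m \in A); last by exists 0%N.
    by rewrite inE => /set_mem[_ [r h]]; exists r.
  have := @vitali_count R _ (fun n => cocycle S g n z) N M L k be q
    (fun n => iter n S z \in B) (fun n => iter n S z \in Q) rad A
    (spB z N).
  rewrite -sum1_card (big_mkcond (fun i => i \in A)) /=.
  have -> : (\sum_(i < N) (if i \in A then 1 else 0)
      = \sum_(i < N) (z \in (iter i S @^-1` bad M)))%N.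
    apply: eq_bigr => i _.
    have -> : (i \in A) = (z \in iter i S @^-1` bad M) by rewrite !inE.
    by case: ifP.
  have -> : (\sum_(n < N + M) (iter n S z \in Q)
      = \sum_(n < N + M) (z \in (iter n S @^-1` Q)))%N.
    by apply: eq_bigr => i _; congr nat_of_bool; apply/idP/idP => /set_mem h; apply/mem_set.
  apply => m mA; have [r0 h] := radP m mA; split => //.
    by move: mA; rewrite !inE => -[].
  apply: leq_trans h _; rewrite leq_mul2l; apply/orP; right.
  apply: leq_sum => n _.
  by rewrite cocycle_add addrAC subrr add0r -iterD addnC.
have badM M : be%:R * fine (P (bad M)) <= C%:R * fine (P Q).
  rewrite leNgt; apply/negP => lt.
  pose e := be%:R * fine (P (bad M)) - C%:R * fine (P Q).
  have e0 : 0 < e by rewrite subr_gt0.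
  (* For this [N] the boundary term [C * M * P Q] of [finite_window] is smaller than [N * e]. *)
  pose N := (Num.truncn (C%:R * M%:R * fine (P Q) / e)).+1.
  have := finite_window N M.
  have hN : C%:R * M%:R * fine (P Q) / e < N%:R by exact: truncnS_gt.
  rewrite leNgt => /negP; apply; rewrite natrD.
  move: hN; rewrite ltr_pdivrMr // /e => hN; lra.
have [->|be0] := eqVneq be 0%N.
  by rewrite mul0r mulr_ge0 // fine_prob_ge0.
have beR : (0 : R) < be%:R by rewrite ltr0n lt0n.
rewrite -ler_pdivlMl // (_ : mkset _ = \bigcup_M bad M).
  apply: fine_prob_bigcup_le => // M; by rewrite ler_pdivlMl.
apply/seteqP; split=> z.
  by move=> [Bz [r [M h]]]; exists M => //; split => //; exists r.
by move=> [M _ [Bz [r h]]]; split => //; exists r, M.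
Qed.

End orbit_counting.

(** * Grids *)

Lemma leq_expl (a b e : nat) : (a <= b)%N -> (a ^ e <= b ^ e)%N.
Proof. by case: e => [//|e]; rewrite leq_exp2r. Qed.

Section grid.
Context (R : realType) (k : nat).

(* The cube of side [s] containing [v], for [v] in the box of radius [rho]. *)
Definition cell (s rho : R) (m : nat) (v : 'rV[R]_k) : {ffun 'I_k -> 'I_m.+1} :=
  [ffun i => inord (Num.truncn ((v ord0 i + rho) / s))].

Section cellE.
Variables (s rho : R) (m : nat).
Hypotheses (s0 : 0 < s) (sm : 2 * rho / s < m.+1%:R).

Lemma cell_coord (v : 'rV[R]_k) i : `|v| <= rho ->
  (cell s rho m v i : nat)%:R <= (v ord0 i + rho) / s
    < (cell s rho m v i : nat).+1%:R.
Proof.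
move=> vrho; have rho0 : 0 <= rho by exact: le_trans vrho.
have /(rV_norm_le _ rho0)/(_ i) := vrho; rewrite ler_norml => /andP[h1 h2].
have x0 : 0 <= (v ord0 i + rho) / s.
  by rewrite divr_ge0 ?(ltW s0) // -lerBlDr sub0r.
(* By [sm] the integer part is at most [m], so [inord] returns it unchanged. *)
rewrite ffunE inordK; first by exact: truncn_itv.
rewrite truncn_lt_nat // (le_lt_trans _ sm) // ler_pM2r ?invr_gt0 //; lra.
Qed.

Lemma cell_eq (v : 'rV[R]_k) (c : {ffun 'I_k -> 'I_m.+1}) : `|v| <= rho ->
  (forall i, (c i : nat)%:R <= (v ord0 i + rho) / s < (c i : nat).+1%:R) ->
  cell s rho m v = c.
Proof.
move=> vrho cv; apply/ffunP => i; apply: val_inj => /=.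
have /andP[h1 h2] := cell_coord i vrho; have /andP[h3 h4] := cv i.
have := le_lt_trans h1 h4; have := le_lt_trans h3 h2; rewrite !ltr_nat; lia.
Qed.

Lemma cell_close (v w : 'rV[R]_k) : `|v| <= rho -> `|w| <= rho ->
  cell s rho m v = cell s rho m w -> `|v - w| <= s.
Proof.
move=> vr wr e; apply/rV_norm_le => [|i]; first exact: ltW.
have /andP[h1 h2] := cell_coord i vr.
have := cell_coord i wr; rewrite -e => /andP[h3 h4].
set c := (cell _ _ _ _ _ : nat) in h1 h2 h3 h4.
move: h1 h2 h3 h4; rewrite ler_pdivlMr // ltr_pdivrMr // ler_pdivlMr // ltr_pdivrMr //.
rewrite -natr1 !mxE mulrDl mul1r => h1 h2 h3 h4.
rewrite ler_norml; apply/andP; split; lra.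
Qed.

End cellE.
End grid.

(** Subtracting the least element of [D] embeds [D] in ['I_n0.+1]. *)
Lemma card_bounded_gaps (N n0 : nat) (D : {set 'I_N}) :
  (forall i j, i \in D -> j \in D -> (i < j)%N -> (j < i + n0)%N) ->
  (#|D| <= n0.+1)%N.
Proof.
move=> gap; have [->|[i0 i0D]] := set_0Vmem D; first by rewrite cards0.
pose a := [arg min_(i < i0 in D) (i : nat)]%N.
have [aD amin] : a \in D /\ forall i, i \in D -> (a <= i)%N.
  by rewrite /a; case: arg_minnP.
pose h (i : 'I_N) : 'I_n0.+1 := inord (i - a).
have hE i : i \in D -> h i = (i - a)%N :> nat.
  move=> iD; rewrite inordK // ltnS leq_subLR.
  have [ai|ia] := ltnP a i; first exact: ltnW (gap _ _ aD iD ai).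
  exact: leq_trans ia (leq_addr _ _).
have hinj : {in D &, injective h}.
  move=> i j iD jD /(congr1 val) /=; rewrite !hE // => e; apply: val_inj => /=.
  have := amin _ iD; have := amin _ jD; lia.
rewrite -(card_in_imset hinj) -[leqRHS]card_ord; exact: max_card.
Qed.

(** Cut the ball into cubes of side [1 / (c + 1)]. Two visits in one cube at times [i < i'] make the
    cocycle started at time [i] small after [i' - i] steps, which forces [i' - i < n0]. So each cube
    receives at most [n0 + 1] visits. *)
Lemma sparse_escape (R : realType) (k : nat) (Z : Type) (S : Z -> Z)
    (g : Z -> 'rV[R]_k) (n0 c : nat) :
  sparse S g [set z | forall n, (n0 <= n)%N ->
                ~ (`|cocycle S g n z| <= (c.+1%:R)^-1)]
    (n0.+1 * (2 * c + 3) ^ k).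
Proof.
move=> z N v r r0; set E := mkset _.
pose A := [set n : 'I_N | (iter n S z \in E) &&
                          (`|cocycle S g n z - v| <= r%:R)%R]%SET.
pose m := (2 * r * c.+1)%N.
pose cl (n : 'I_N) := cell (c.+1%:R)^-1 r%:R m (cocycle S g n z - v).
have -> : (\sum_(n < N) ((iter n S z \in E) &&
                          (`|cocycle S g n z - v| <= r%:R)%R))%N = #|A|.
  rewrite -sum1_card [RHS]big_mkcond /=; apply: eq_bigr => n _.
  by rewrite finset.in_set; case: ifP.
rewrite -sum1_card (partition_big cl predT) //=.
apply: (@leq_trans (\sum_(j : {ffun 'I_k -> 'I_m.+1}) n0.+1)%N).
  apply: leq_sum => j _.
  pose D := [set n in A | cl n == j]%SET.
  rewrite (eq_bigl (fun n => n \in D)); last by move=> n; rewrite !finset.in_set.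
  rewrite sum1_card; apply: card_bounded_gaps => i i'.
  rewrite !finset.in_set => /andP[/andP[/set_mem Ei ri] /eqP ei].
  move=> /andP[/andP[/set_mem Ei' ri'] /eqP ei'] ii'.
  rewrite ltnNge; apply/negP => n0i.
  have n0le : (n0 <= i' - i)%N by lia.
  apply: (Ei _ n0le).
  have -> : cocycle S g (i' - i) (iter i S z) =
      (cocycle S g i' z - v) - (cocycle S g i z - v).
    rewrite -{2}(subnKC (ltnW ii')) cocycle_add.
    by rewrite opprB addrA subrK addrAC subrr add0r.
  apply: cell_close ri' ri _; last by rewrite -[LHS]/(cl i') ei' -ei.
    by rewrite invr_gt0 ltr0n.
  by rewrite invrK -!natrM ltr_nat /m.
rewrite sum_nat_const card_ffun !card_ord mulnC -mulnA leq_mul2l /=.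
(* There are [2 * r * (c + 1) + 1] cubes per axis, at most [(2 * c + 3) * r] since [r] is
   positive. *)
rewrite -expnMn; apply: leq_expl; rewrite /m; nia.
Qed.

(** * Upper density of cocycles *)

(** An integer form of [(1 + c / r) ^ k] tending to [1], used to absorb enlarged radii. The
    induction hypothesis is taken at [2 * a], leaving half of the allowed loss for the last
    factor. *)
Lemma eventually_leq_shift_expn (k a c : nat) :
  exists rho, forall r, (rho <= r)%N -> (a * (r + c) ^ k <= a.+1 * r ^ k)%N.
Proof.
elim: k a => [|k IH] a.
  by exists 0%N => r _; rewrite !expn0 !muln1.
have [rho h] := IH (2 * a)%N.
exists (maxn rho ((2 * a).+1 * c))%N => r; rewrite geq_max => /andP[/h {}h ar].
rewrite !expnS -(@leq_pmul2l 2) //.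
apply: (@leq_trans ((2 * a).+1 * r ^ k * (r + c))%N).
  by move: (leq_mul h (leqnn (r + c)%N)); lia.
have : ((2 * a).+1 * (r + c) <= (2 * a).+2 * r)%N by lia.
move=> /(leq_mul (leqnn (r ^ k)%N)); lia.
Qed.

Section density.
Context (R : realType) (k : nat).

(* The limsup over [r] of [r ^- k] times the number of all [n] with
   [`|cocycle S g n z| <= r] is at most [lam]. *)
Definition density_le (Z : Type) (S : Z -> Z) (g : Z -> 'rV[R]_k) (lam : nat)
    (z : Z) : Prop :=
  forall q, exists rho, forall r, (rho <= r)%N -> forall M,
    (q * hits S g setT M r z <= (q * lam + 1) * r ^ k)%N.

(** Radii below the threshold are compared with the threshold itself, using that counts increase
    with the radius and [1 <= r ^ k]. *)
Lemma density_le_bounded (Z : Type) (S : Z -> Z) (g : Z -> 'rV[R]_k) lam z :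
  density_le S g lam z ->
  exists l, forall r M, (0 < r)%N -> (hits S g setT M r z <= l * r ^ k)%N.
Proof.
move=> /(_ 1%N)[rho h]; exists ((lam + 1) * rho ^ k + (lam + 1))%N => r M r0.
have [rhor|rrho] := leqP rho r.
  by have := h r rhor M; rewrite !mul1n => /leq_trans; apply; rewrite leq_mul2r leq_addl orbT.
have := h rho (leqnn _) M; rewrite !mul1n => hrho.
apply: leq_trans (hits_le_radius _ _ _ _ _ (ltnW rrho)) _.
apply: leq_trans hrho _; apply: leq_trans (leq_addr (lam + 1) _) _.
by rewrite leq_pmulr // expn_gt0 r0.
Qed.

Context d (Z : measurableType d).
Variables (P : probability Z R) (S : Z -> Z).
Hypothesis mS : measurable_fun setT S.
Hypothesis pS : forall A, measurable A -> P (S @^-1` A) = P A.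

Lemma measurable_density_le (g : Z -> 'rV[R]_k) lam : borel_vec_map g ->
  measurable [set z | density_le S g lam z].
Proof.
move=> mg; apply: measurable_forall => q; apply: measurable_exists => rho.
apply: measurable_forall => r; apply: measurable_imply => _.
apply: measurable_forall => M.
exact: (@measurable_hits _ _ _ _ S g mS mg setT M r
  [set n | (q * n <= (q * lam + 1) * r ^ k)%N]).
Qed.

(** By the maximal inequality with [Q] the whole space, the points of [B] having [lam * r ^ k]
    visits at some radius have measure at most [L * 2 ^ k / lam]. This is less than [P B] for large
    [lam]. *)
Lemma density_le_pos (g : Z -> 'rV[R]_k) (B : set Z) (L : nat) :
  borel_vec_map g -> measurable B -> sparse S g B L -> 0 < fine (P B) ->
  exists lam, 0 < fine (P [set z | density_le S g lam z]).
Proof.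
move=> mg mB spB PB.
pose lam := (Num.truncn ((L * 2 ^ k * 1)%:R / fine (P B))).+1.
have lamP : (L * 2 ^ k * 1)%:R / fine (P B) < lam%:R by exact: truncnS_gt.
exists lam.
set bad := [set z | B z /\ exists r M, (0 < r)%N /\
                           (lam * r ^ k <= 1 * hits S g setT M r z)%N].
have mbad : measurable bad.
  apply: measurable_and => //; do 2 apply: measurable_exists => ?.
  apply: measurable_const_and => _.
  exact: (@measurable_hits _ _ _ _ S g mS mg setT _ _
    [set n | (lam * _ ^ k <= 1 * n)%N]).
have := @maximal_inequality _ _ _ _ P S g mS mg pS B setT L lam 1 mB measurableT spB.
rewrite -/bad probability_setT /= mulr1 => hbad.
have lt : fine (P bad) < fine (P B).
  move: lamP; rewrite ltr_pdivrMr // => /(le_lt_trans hbad).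
  by rewrite ltr_pM2l // ltr0n.
have sub : B `\` bad `<=` [set z | density_le S g lam z].
  move=> z [Bz nbad] q; exists 1%N => r r0 M.
  rewrite mulnDl mul1n; apply: leq_trans (leq_addr _ _).
  rewrite -mulnA leq_mul2l; apply/orP; right.
  rewrite leqNgt; apply/negP => /ltnW h; apply: nbad; split => //.
  by exists r, M; rewrite mul1n.
apply: lt_le_trans (le_fine_prob P _ _ sub).
- rewrite measureD ?ltey_eq ?fin_num_measure // setIidr; last by move=> z [].
  by rewrite fineB ?fin_num_measure // subr_gt0.
- exact: measurableD.
- exact: measurable_density_le.
Qed.

Section cohomologous.
Variables (g g' b : Z -> 'rV[R]_k).
Hypotheses (mg : borel_vec_map g) (mg' : borel_vec_map g').
Hypothesis mb : borel_vec_map b.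
Hypothesis cob : forall n z,
  cocycle S g' n z = cocycle S g n z - b (iter n S z) + b z.

(** The sets on which the maximal inequality for [g'] is applied; every point of finite density for
    [g] lies in one of them. *)
Let tame l c := [set z | (forall r M, (0 < r)%N ->
    (hits S g setT M r z <= l * r ^ k)%N) /\ `|b z| <= c%:R].

Let large m := [set z | ~ (`|b z| <= m%:R)].

(** Recentre at the first counted visit [n1]. Seen from there, the later ones are visits of the
    cocycle of [g] to radius [2 * r + 2 * c], and tameness at [n1] bounds their number. *)
Lemma sparse_tame l c : sparse S g' (tame l c) (l * (2 + 2 * c) ^ k).
Proof.
move=> z N v r r0.
pose F n : bool := (iter n S z \in tame l c) && (`|cocycle S g' n z - v| <= r%:R).
have [/existsP[i Fi]|/existsPn noF] := boolP [exists i : 'I_N, F i]; last first.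
  by rewrite big1 // => i _; have := noF i; rewrite /F => /negbTE ->.
have exF : exists n, F n by exists i.
pose n1 := ex_minn exF.
have [Fn1 n1min] : F n1 /\ forall n, F n -> (n1 <= n)%N.
  by rewrite /n1; case: ex_minnP.
have n1N : (n1 <= N)%N by apply: leq_trans (n1min _ Fi) _; exact: ltnW.
have /andP[/set_mem[tn1 bn1] vn1] := Fn1.
pose r' := ((2 + 2 * c) * r)%N.
have r'0 : (0 < r')%N by rewrite muln_gt0 r0.
apply: leq_trans (_ : (hits S g setT (N - n1) r' (iter n1 S z) <= _)%N); last first.
  by apply: leq_trans (tn1 _ _ r'0) _; rewrite /r' expnMn mulnA.
rewrite -(big_mkord predT (fun n => F n : nat)) (@big_cat_nat _ _ _ n1) //=.
rewrite big1_seq ?add0n; last first.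
  move=> n; rewrite mem_index_iota => /andP[_ /andP[_ nn1]].
  by case Fn: (F n) => //; have := n1min _ Fn; rewrite leqNgt nn1.
rewrite -{1}[n1]add0n big_addn big_mkord; apply: leq_sum => n _.
rewrite [(_ \in setT)]mem_set //=.
have [/andP[/set_mem[_ bn] vn]|//] := boolP (F (n + n1)%N).
rewrite (_ : (_ <= _) = true) //.
have -> : cocycle S g n (iter n1 S z) = (cocycle S g' (n + n1) z - v)
    - (cocycle S g' n1 z - v) + b (iter (n + n1) S z) - b (iter n1 S z).
  rewrite !cob [(n + n1)%N]addnC cocycle_add.
  apply/rowP => j; rewrite !mxE; ring.
apply: le_trans (ler_normB _ _) _.
apply: le_trans (lerD (ler_normD _ _) (lexx _)) _.
apply: le_trans (lerD (lerD (ler_normB _ _) (lexx _)) (lexx _)) _.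
have : (2 * r + 2 * c)%:R <= r'%:R :> R by rewrite ler_nat /r'; nia.
rewrite natrD !natrM; move: vn1 vn bn bn1; lra.
Qed.

(** The two cocycles differ by [b] at both ends of the orbit segment: by at most [c] at the start,
    and by at most [m] at the end unless the orbit is then in [large m]. *)
Lemma hits_cohomologous l c m M r z : tame l c z ->
  (hits S g' setT M r z <=
   hits S g setT M (r + m + c) z + hits S g' (large m) M r z)%N.
Proof.
move=> [_ bz]; rewrite /hits -big_split /=; apply: leq_sum => n _.
rewrite ![(_ \in setT)]mem_set //=.
have [h|//] := boolP (`|cocycle S g' n z| <= r%:R); rewrite andbT.
have [bn|bn] := boolP (`|b (iter n S z)| <= m%:R); last first.
  rewrite [X in (_ <= _ + nat_of_bool X)%N]mem_set ?leq_addl //.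
  by move=> bn'; rewrite bn' in bn.
rewrite (_ : (_ <= (r + m + c)%:R) = true) ?leq_addr //.
have -> : cocycle S g n z = cocycle S g' n z + b (iter n S z) - b z.
  by rewrite cob; apply/rowP => j; rewrite !mxE; ring.
apply: le_trans (ler_normB _ _) _; rewrite !natrD lerD //.
by apply: le_trans (ler_normD _ _) _; rewrite lerD.
Qed.

Lemma large_small (e : R) : 0 < e -> exists m, fine (P (large m)) < e.
Proof.
move=> e0.
have mF m : measurable [set z | `|b z| <= m%:R].
  exact: measurable_rV_norm_le.
have ndF : nondecreasing_seq (fun m : nat => [set z | `|b z| <= m%:R]).
  move=> m m' mm'; apply/subsetPset => z /= h; apply: le_trans h _.
  by rewrite ler_nat.
have [m hm] := fine_prob_bigcup_approx P mF ndF e0.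
exists m; rewrite (_ : large m = ~` [set z | `|b z| <= m%:R]) // fine_probC //.
move: hm; rewrite (_ : \bigcup_n _ = setT) ?probability_setT /=; first by lra.
apply/seteqP; split => // z _; exists (Num.truncn `|b z|).+1 => //=.
exact/ltW/truncnS_gt.
Qed.

(** The visits lost to [large m] have small density for suitable [m], since the measure of [large m]
    tends to zero and the maximal inequality applies. The others are visits for [g] in a ball whose
    radius grew by a constant, which does not affect the limsup. *)
Lemma density_le_cohomologous lam :
  P.-negligible [set z | density_le S g lam z /\ ~ density_le S g' lam z].
Proof.
pose W l c q := [set z | tame l c z /\ forall m, exists r M, (0 < r)%N /\
   (1 * r ^ k <= q * hits S g' (large m) M r z)%N].
have mtame l c : measurable (tame l c).
  apply: measurable_and; last exact: measurable_rV_norm_le.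
  do 2 apply: measurable_forall => ?; apply: measurable_imply => _.
  exact: (@measurable_hits _ _ _ _ S g mS mg setT _ _
    [set n | (n <= l * _ ^ k)%N]).
have mlarge m : measurable (large m).
  by apply: measurableC; exact: measurable_rV_norm_le.
have mWm l c q m : measurable [set z | tame l c z /\ exists r M, (0 < r)%N /\
   (1 * r ^ k <= q * hits S g' (large m) M r z)%N].
  apply: measurable_and; first exact: mtame.
  do 2 apply: measurable_exists => ?; apply: measurable_const_and => _.
  exact: (@measurable_hits _ _ _ _ S g' mS mg' (large m) _ _
    [set n | (1 * _ ^ k <= q * n)%N]).
have mW l c q : measurable (W l c q).
  rewrite (_ : W l c q = \bigcap_m [set z | tame l c z /\ exists r M, (0 < r)%N /\
    (1 * r ^ k <= q * hits S g' (large m) M r z)%N]).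
    exact: bigcapT_measurable.
  apply/seteqP; split=> z.
    by move=> [tz h] m _; split.
  by move=> h; split => [|m]; [have [] := h 0%N I|have [] := h m I].
(* The maximal inequality bounds [P (W l c q)] by [C * P (large m)] for every [m]; [C.+1] in the
   choice of [m] avoids dividing by zero. *)
have W0 l c q : P (W l c q) = 0%E.
  apply: prob0_fine => //; apply/eqP; rewrite eq_le fine_prob_ge0 andbT.
  set C := ((l * (2 + 2 * c) ^ k) * 2 ^ k * q)%N.
  rewrite leNgt; apply/negP => W0.
  have e0 : 0 < fine (P (W l c q)) / C.+1%:R by rewrite divr_gt0 ?ltr0n.
  have [m hm] := large_small e0.
  have := @maximal_inequality _ _ _ _ P S g' mS mg' pS _ _ _ 1 q
    (mtame l c) (mlarge m) (@sparse_tame l c).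
  rewrite -/C mul1r; apply/negP; rewrite -ltNge.
  apply: (@lt_le_trans _ _ (fine (P (W l c q)))); last first.
    by apply: le_fine_prob => // z [tz h]; split => //; exact: h.
  move: hm; rewrite ltr_pdivlMr ?ltr0n // => hm; apply: le_lt_trans hm.
  by rewrite mulrC ler_wpM2l ?fine_prob_ge0 // ler_nat.
have : P.-negligible (\bigcup_l \bigcup_c \bigcup_q W l c q).
  by do 3 apply: negligible_bigcup => ?; apply/negligibleP; [exact: mW|exact: W0].
apply: negligibleS => z /= [dz ndz]; apply: contrapT => nW; apply: ndz => q.
have [->|q0] := posnP q; first by exists 0%N => *; rewrite mul0n.
have [l hl] := density_le_bounded dz.
pose c := (Num.truncn `|b z|).+1.
have tz : tame l c z by split => //; exact/ltW/truncnS_gt.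
have [m hm] : exists m, forall r M, (0 < r)%N ->
    (4 * q * hits S g' (large m) M r z < r ^ k)%N.
  apply: contrapT => /forallNP hN; apply: nW.
  exists l => //; exists c => //; exists (4 * q)%N => //; split=> // m.
  have /existsNP[r /existsNP[M /not_implyP[r0 /negP]]] := hN m.
  by rewrite -leqNgt => h; exists r, M; rewrite mul1n.
(* The allowed excess [1 / q] is split in quarters: one for the density of [g], one for the larger
   radius, one for the visits to [large m]. *)
have [rho1 h1] := dz (4 * q)%N.
have [rho2 h2] := eventually_leq_shift_expn k (4 * q * lam + 1) (m + c).
exists (rho1 + rho2 + 1)%N => r rr M.
have /(_ M) {}h1 := h1 (r + (m + c))%N (ltac:(lia) : (rho1 <= r + (m + c))%N).
have {}h2 := h2 r (ltac:(lia) : (rho2 <= r)%N).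
have /(_ M) {}hm := hm r ^~ (ltac:(lia) : (0 < r)%N).
have hh := hits_cohomologous m M r tz; rewrite -addnA in hh.
rewrite -(@leq_pmul2l 4) //.
move: hh h1 h2 hm; set x := hits _ _ _ _ _ _; set y := hits _ _ _ _ _ _.
set w := hits _ _ _ _ _ _; set u := (r ^ k)%N; set u' := ((_ + _) ^ k)%N.
move=> hh h1 h2 hm; nia.
Qed.

End cohomologous.
End density.

(** * Zero-one law on the product *)

Section almost_invariant.
Context (R : realType) d (X : measurableType d) (mu : probability X R).
Variable T : X -> X.
Hypothesis mT : measurable_fun setT T.
Hypothesis pT : forall A, measurable A -> mu (T @^-1` A) = mu A.

(** Up to a null set, [A] equals the set of points visiting [A] infinitely often, which is strictly
    invariant. *)
Lemma ergodic_almost_invariant (A : set X) : ergodic mu T -> measurable A ->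
  mu (A `\` T @^-1` A) = 0%E -> mu A = 0%E \/ mu A = 1%E.
Proof.
move=> ergT mA A0; pose B := T @^-1` A.
have mB : measurable B by exact: measurable_preim mT mA.
(* As [A] and [B] have the same finite measure, their two differences do too. *)
have B0 : mu (B `\` A) = 0%E.
  have h : mu (A `\` B) = (mu A - mu (A `&` B))%E.
    by rewrite measureD ?ltey_eq ?fin_num_measure.
  have hB : mu (B `\` A) = (mu B - mu (B `&` A))%E.
    by rewrite measureD ?ltey_eq ?fin_num_measure.
  by rewrite hB (pT mA : mu B = mu A) setIC -h.
pose D := (A `\` B) `|` (B `\` A).
have mD : measurable D by apply: measurableU; exact: measurableD.
have D0 : mu D = 0%E.
  by apply: null_set_setU => //; exact: measurableD.
pose N := \bigcup_n (iter n T @^-1` D).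
have mN : measurable N.
  by apply: bigcupT_measurable => n; exact: measurable_preim (measurable_iter _ mT) mD.
have N0 : mu N = 0%E.
  apply/negligibleP => //; apply: negligible_bigcup => n; apply/negligibleP.
    exact: measurable_preim (measurable_iter _ mT) mD.
  by rewrite -[RHS]D0; exact: measure_preserving_iter.
pose A' := [set x | forall n, exists m, (n <= m)%N /\ A (iter m T x)].
have mA' : measurable A'.
  apply: measurable_forall => n; apply: measurable_exists => m.
  apply: measurable_const_and => _.
  exact: (measurable_preim (measurable_iter m mT) mA).
have invA' : T @^-1` A' = A'.
  apply/seteqP; split=> x /= h n.
    by have [m [nm hm]] := h n; exists m.+1; split; [exact: leqW|rewrite iterSr].
  (* Asking for a visit after time [n.+1] excludes [m = 0], so one step can be moved into the
     starting point. *)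
  have [[|m] [nm hm]] := h n.+1; first by [].
  by exists m; rewrite -iterSr.
have orb x : ~ N x -> forall n, A (iter n T x) <-> A x.
  move=> nN; elim=> [//|n IH]; rewrite -IH.
  have nD : ~ D (iter n T x) by move=> Dx; apply: nN; exists n.
  split=> h; apply: contrapT => h'; apply: nD; [right|left]; split => //.
have AA' x : ~ N x -> A x <-> A' x.
  move=> nN; split=> [Ax n|/(_ 0%N)[m [_ /orb]]]; last by apply.
  by exists n; split => //; apply/orb.
have le1 : (mu A <= mu A')%E.
  rewrite -(measureU0 mA' mN N0); apply: le_measure; rewrite ?inE //.
    exact: measurableU.
  by move=> x Ax; have [Nx|nNx] := pselect (N x); [right|left; exact/AA'].
have le2 : (mu A' <= mu A)%E.
  rewrite -(measureU0 mA mN N0); apply: le_measure; rewrite ?inE //.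
    exact: measurableU.
  by move=> x Ax; have [Nx|nNx] := pselect (N x); [right|left; exact/AA'].
have -> : mu A = mu A' by apply/eqP; rewrite eq_le le1.
exact: ergT.
Qed.

End almost_invariant.

Section product_system.
Context (R : realType) d (X : measurableType d) (mu : probability X R).

Let prod_setT : ((mu \x mu) setT = 1)%E.
Proof.
rewrite -setXTT; transitivity (mu setT * mu setT)%E.
  exact: product_measure1E.
by rewrite probability_setT mule1.
Qed.

HB.instance Definition _ :=
  Measure_isProbability.Build _ _ _ (mu \x mu)%E prod_setT.

Lemma ae_xsection_null (N : set (X * X)) : measurable N ->
  (mu \x mu)%E N = 0%E -> {ae mu, forall x, mu (xsection N x) = 0%E}.
Proof.
move=> mN N0.
have mf : measurable_fun setT (mu \o xsection N) by exact: measurable_fun_xsection.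
have [+ _] := ae_eq_integral_abs mu measurableT mf.
have -> : (\int[mu]_x `|(mu \o xsection N) x| = 0)%E.
  rewrite -[RHS]N0; apply: eq_integral => x _; rewrite gee0_abs //; exact: measure_ge0.
by move=> /(_ erefl); apply: filterS => x; apply.
Qed.

Variable T : X -> X.
Hypothesis mT : measurable_fun setT T.
Hypothesis pT : forall A, measurable A -> mu (T @^-1` A) = mu A.

Lemma measurable_swap_pair_map : measurable_fun setT (swap_pair_map T).
Proof.
apply: measurable_fun_pair.
  exact: (measurableT_comp mT measurable_fst).
exact: (measurableT_comp mT measurable_snd).
Qed.

(** Invariance of [mu] is used twice: inside each section, and as a change of variable in the
    integral over the base. *)
Lemma swap_pair_map_preserving (A : set (X * X)) : measurable A ->
  (mu \x mu)%E (swap_pair_map T @^-1` A) = (mu \x mu)%E A.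
Proof.
move=> mA; rewrite /product_measure1.
have mf : measurable_fun setT (mu \o xsection A) by exact: measurable_fun_xsection.
transitivity (\int[mu]_x (mu (xsection A (T x))))%E.
  apply: eq_integral => x _ /=; rewrite -[RHS]pT; last exact: measurable_xsection.
  congr (mu _); apply/seteqP; split=> y /=; rewrite /xsection /= !inE //.
transitivity (\int[pushforward mu T]_x (mu (xsection A x)))%E.
  by rewrite ge0_integral_pushforward.
apply: eq_measure_integral => B mB _; exact: pT.
Qed.

Hypothesis ergT : ergodic mu T.

(** Invariance in the second coordinate makes almost every section null or full; invariance in the
    first makes the set of full sections almost invariant. Treating the factors separately relies
    only on ergodicity of [T], whereas [T] x [T] may fail to be ergodic. *)
Lemma product_zero_one (G : set (X * X)) : measurable G ->
  (mu \x mu)%E.-negligible [set z | G z /\ ~ G (z.1, T z.2)] ->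
  (mu \x mu)%E.-negligible [set z | G z /\ ~ G (T z.1, z.2)] ->
  (mu \x mu)%E G = 0%E \/ (mu \x mu)%E G = 1%E.
Proof.
move=> mG n1 n2.
have m1 : measurable [set z | G z /\ ~ G (z.1, T z.2)].
  apply: measurableI => //; apply: measurableC.
  apply: (@measurable_preim _ _ _ _ (fun z : X * X => (z.1, T z.2)) G) => //.
  apply: measurable_fun_pair; first exact: measurable_fst.
  exact: (measurableT_comp mT measurable_snd).
have m2 : measurable [set z | G z /\ ~ G (T z.1, z.2)].
  apply: measurableI => //; apply: measurableC.
  apply: (@measurable_preim _ _ _ _ (fun z : X * X => (T z.1, z.2)) G) => //.
  apply: measurable_fun_pair; last exact: measurable_snd.
  exact: (measurableT_comp mT measurable_fst).
have /(ae_xsection_null m1) a1 := (negligibleP _ m1).1 n1.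
have /(ae_xsection_null m2) a2 := (negligibleP _ m2).1 n2.
have mf : measurable_fun setT (mu \o xsection G) by exact: measurable_fun_xsection.
have mGx x : measurable (xsection G x) by exact: measurable_xsection.
pose A := [set x | mu (xsection G x) = 1%E].
have mA : measurable A by exact: measurable_preim mf (emeasurable_set1 _).
have sec01 : {ae mu, forall x, mu (xsection G x) = (\1_A x : R)%:E}.
  apply: filterS a1 => x h; rewrite indicE.
  have [xA|xA] := boolP (x \in A); first exact: (set_mem xA).
  have h' : mu (xsection G x `\` T @^-1` xsection G x) = 0%E.
    rewrite -[RHS]h; congr (mu _).
    by apply/seteqP; split=> y; rewrite /xsection /= !inE.
  have [//|h1] := ergodic_almost_invariant mT pT ergT (mGx x) h'.
  by move/negP: xA; case; apply/mem_set.
have muG : (mu \x mu)%E G = mu A.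
  transitivity (\int[mu]_x (\1_A x)%:E)%E; last first.
    by rewrite integral_indic // setIT.
  apply: ge0_ae_eq_integral => //.
  - exact/measurable_EFinP/measurable_indic.
  - by apply: filterS sec01 => x h _.
rewrite muG; apply: (ergodic_almost_invariant mT pT ergT mA).
have mTA : measurable (T @^-1` A) by exact: measurable_preim mT mA.
apply/negligibleP; first exact: measurableD.
(* Outside the null set of [a2], the section over [T x] contains the one over [x] up to a null set,
   so it is full as well. *)
apply: negligibleS a2 => x [Ax nATx] /= h; apply: nATx.
apply/eqP; rewrite eq_le probability_le1 //= -Ax.
rewrite -(measureU0 (mGx (T x)) (measurable_xsection x m2) h).
apply: le_measure; rewrite ?inE //.
  by apply: measurableU => //; exact: measurable_xsection.
move=> y; rewrite /xsection /= !inE => Gy.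
by have [Gt|nG] := pselect (G (T x, y)); [left|right].
Qed.

End product_system.

(** * Small balls *)

(** Cauchy-Schwarz, read off from the nonnegative sum of squared deviations from the mean. *)
Lemma sqr_sum_le (R : realFieldType) (I : finType) (p : I -> R) :
  (\sum_i p i) ^+ 2 <= #|I|%:R * \sum_i p i ^+ 2.
Proof.
have [I0|I0] := posnP #|I|.
  by rewrite big_pred0 ?expr0n ?I0 ?mul0r // => i; have /card0_eq/(_ i) := I0.
set s := \sum_i p i; set n : R := #|I|%:R.
have n0 : 0 < n by rewrite ltr0n.
have : 0 <= \sum_i (p i - s / n) ^+ 2 by apply: sumr_ge0 => i _; exact: sqr_ge0.
under eq_bigr do rewrite sqrrB.
rewrite big_split /= sumrB sumr_const -/n -mulr_natl -/n.
rewrite sumrMnl -mulr_suml -/s => h.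
have : 0 <= n * (\sum_i p i ^+ 2 - s * (s / n) *+ 2 + n * (s / n) ^+ 2).
  by rewrite mulr_ge0 // ltW.
have -> : n * (\sum_i p i ^+ 2 - s * (s / n) *+ 2 + n * (s / n) ^+ 2)
   = n * (\sum_i p i ^+ 2) - s ^+ 2 by field; rewrite gt_eqF.
by rewrite subr_ge0.
Qed.

Section difference_cocycle.
Context (R : realType) (k : nat) (X : Type) (T : X -> X) (f : X -> 'rV[R]_k).

Lemma iter_swap_pair_map n z :
  iter n (swap_pair_map T) z = (iter n T z.1, iter n T z.2).
Proof. by elim: n => [|n IH] /=; [case: z|rewrite IH]. Qed.

Lemma cocycle_diff_map n z :
  cocycle (swap_pair_map T) (diff_map f) n z =
  cocycle T f n z.1 - cocycle T f n z.2.
Proof.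
by rewrite /cocycle -sumrB; apply: eq_bigr => i _; rewrite /diff_map iter_swap_pair_map.
Qed.

End difference_cocycle.

Section small_ball.
Context (R : realType) d (X : measurableType d) (mu : probability X R) (k : nat).
Variables (T : X -> X) (f : X -> 'rV[R]_k).
Hypothesis mT : measurable_fun setT T.
Hypothesis mf : borel_vec_map f.

Lemma borel_vec_diff_map : borel_vec_map (diff_map f).
Proof.
move=> i; rewrite /diff_map.
under eq_fun do rewrite !mxE.
apply: measurable_funB.
  exact: (measurableT_comp (mf i) measurable_fst).
exact: (measurableT_comp (mf i) measurable_snd).
Qed.

Lemma borel_vec_normalized n : borel_vec_map (normalized_cocycle T f n).
Proof.
move=> i; rewrite /normalized_cocycle; under eq_fun do rewrite !mxE.
by apply: measurable_funM => //; exact: borel_vec_cocycle.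
Qed.

(* Two independent points fall in the same one of [N] cubes of side [r] with
   probability at least [eps ^ 2 / N]. *)
Lemma small_ball_lower (eps K : R) (t r : nat) : (0 < k)%N -> 0 < eps -> 0 < K ->
  (0 < r)%N -> (r ^ k <= t)%N ->
  (eps%:E < mu [set x | (`| normalized_cocycle T f t x | <= K)%R])%E ->
  eps ^+ 2 / (2 * K + 1) ^+ k * (r ^ k)%:R / t%:R <=
  fine ((mu \x mu)%E
    [set z | `|cocycle (swap_pair_map T) (diff_map f) t z| <= r%:R]).
Proof.
move=> k0 e0 K0 r0 rt; set B := mkset _ => hB.
have t0 : (0 < t)%N by apply: leq_trans rt; rewrite expn_gt0 r0.
pose tau : R := t%:R `^ (k%:R)^-1.
have tau0 : 0 < tau by rewrite powR_gt0 // ltr0n.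
have tauk : tau ^+ k = t%:R.
  rewrite -powR_mulrn ?(ltW tau0) // -powRrM mulVf ?powRr1 //.
  by rewrite pnatr_eq0 -lt0n.
have rR : (0 : R) < r%:R by rewrite ltr0n.
have rtau : r%:R <= tau.
  by rewrite -(@ler_pXn2r _ k) ?nnegrE ?(ltW tau0) // tauk -natrX ler_nat.
pose rho := K * tau; pose m := Num.truncn (2 * rho / r%:R).
have sm : 2 * rho / r%:R < m.+1%:R by exact: truncnS_gt.
have rho0 : 0 < rho by exact: mulr_gt0.
have BE : B = [set x | `|cocycle T f t x| <= rho].
  apply/seteqP; split=> x; rewrite /B /= /normalized_cocycle normrZ -/tau;
  by rewrite gtr0_norm ?invr_gt0 // ler_pdivrMl // mulrC.
pose A (c : {ffun 'I_k -> 'I_m.+1}) :=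
  [set x | `|cocycle T f t x| <= rho] `&` \bigcap_(i in [set: 'I_k])
    [set x | (c i : nat)%:R <= (cocycle T f t x ord0 i + rho) / r%:R
               < (c i : nat).+1%:R].
have AE x c : `|cocycle T f t x| <= rho ->
    (x \in A c) = (cell r%:R rho m (cocycle T f t x) == c).
  move=> hx; apply/idP/eqP => [/set_mem[_ h]|<-].
    by apply: cell_eq => // i; exact: (h i I).
  by apply/mem_set; split => // i _; exact: cell_coord.
have mcoord i : measurable_fun setT
    (fun x => (cocycle T f t x ord0 i + rho) / r%:R).
  apply: measurable_funM => //; apply: measurable_funD => //.
  exact: (borel_vec_cocycle t mT mf i).
have mA c : measurable (A c).
  apply: measurableI; first exact: measurable_rV_norm_le (borel_vec_cocycle t mT mf).
  apply: fin_bigcap_measurable => // i _.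
  have := measurable_preim (mcoord i)
    (measurable_itv `[((c i : nat)%:R : R), (c i : nat).+1%:R[).
  by congr measurable; apply/seteqP; split=> x; rewrite /preimage /= in_itv.
have mB : measurable B by exact: measurable_rV_norm_le (borel_vec_normalized t).
set W := mkset _.
have mW : measurable W.
  apply: measurable_rV_norm_le; apply: borel_vec_cocycle borel_vec_diff_map.
  exact: measurable_swap_pair_map.
have sum1 : fine (mu B) <= \sum_c fine (mu (A c)).
  have := @sum_measure_le R _ _ mu unit _ (fun=> B) A 1 1.
  rewrite !mul1r big_const card_unit /= addr0; apply => // x.
  rewrite !mul1n big_const card_unit /= addn0.
  have [/set_mem Bx|//] := boolP (x \in B); rewrite BE /= in Bx.
  rewrite (bigD1 (cell r%:R rho m (cocycle T f t x))) //=.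
  by rewrite AE // eqxx leq_addr.
(* The products of [A c] with itself are disjoint, and two values in one cube differ by at most
   [r]. *)
have sum2 : \sum_c fine (mu (A c)) ^+ 2 <= fine ((mu \x mu)%E W).
  have -> : \sum_c fine (mu (A c)) ^+ 2 = \sum_c fine ((mu \x mu)%E (A c `*` A c)).
    apply: eq_bigr => c _; rewrite expr2 -fineM ?fin_num_measure //.
    by congr fine; rewrite product_measure1E.
  have := @sum_measure_le R _ _ (mu \x mu)%E _ unit (fun c => A c `*` A c) (fun=> W) 1 1.
  rewrite !mul1r [\sum_(j : unit) _]big_const card_unit /= addr0; apply => //.
    by move=> c; exact: measurableX.
  move=> z; rewrite !mul1n [in leqRHS]big_const card_unit /= addn0.
  have [[c Ac]|nA] := pselect (exists c, (A c `*` A c) z); last first.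
    rewrite big1 // => c _; apply/eqP; rewrite eqb0; apply/negP => /set_mem Ac.
    by apply: nA; exists c.
  have [[h1 _] [h2 _]] := Ac.
  have e1 : cell r%:R rho m (cocycle T f t z.1) = c.
    by apply/eqP; rewrite -AE //; apply/mem_set; case: Ac.
  have e2 : cell r%:R rho m (cocycle T f t z.2) = c.
    by apply/eqP; rewrite -AE //; apply/mem_set; case: Ac.
  rewrite (bigD1 c) //= big1 ?addn0; last first.
    move=> c' cc'; apply/eqP; rewrite eqb0; apply/negP => /set_mem[Ac' _].
    move: cc'; rewrite -e1 => /negP; apply; rewrite eq_sym -AE //.
    exact/mem_set.
  rewrite (mem_set Ac) mem_set // /W /= cocycle_diff_map.
  by apply: (cell_close rR sm) => //; rewrite e1 e2.
have epsB : eps <= fine (mu B).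
  by rewrite -lee_fin fineK ?fin_num_measure // ltW.
apply: le_trans sum2.
have := sqr_sum_le (fun c => fine (mu (A c))).
rewrite card_ffun !card_ord natrX => hC.
(* The hypothesis [r ^ k <= t], in the form [r <= tau], absorbs the rounding term [1] into
   [tau / r]. *)
have mk : (m.+1%:R : R) <= (2 * K + 1) * tau / r%:R.
  rewrite -natr1 (le_trans (y := 2 * rho / r%:R + 1)) //.
    by rewrite lerD2r truncn_le divr_ge0 // ?ltW // mulr_gt0.
  rewrite ler_pdivlMr // mulrDl divfK ?gt_eqF // /rho; lra.
have mkk : (m.+1%:R : R) ^+ k <= (2 * K + 1) ^+ k * t%:R / (r ^ k)%:R.
  rewrite natrX -tauk -exprMn -exprVn -exprMn.
  by rewrite lerXn2r // nnegrE ?ler0n // (le_trans _ mk).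
have m0 : (0 : R) < m.+1%:R ^+ k by rewrite exprn_gt0 // ltr0n.
apply: (@le_trans _ _ (eps ^+ 2 / m.+1%:R ^+ k)); last first.
  rewrite ler_pdivrMr // mulrC; apply: le_trans hC.
  by rewrite lerXn2r ?nnegrE ?(ltW e0) // (le_trans _ sum1) ?(le_trans _ epsB) // ltW.
rewrite -!mulrA ler_pM2l // ler_pM2l //.
have K1 : 0 < (2 * K + 1) ^+ k by rewrite exprn_gt0 // addr_gt0 // mulr_gt0.
have -> : (2 * K + 1) ^- k * ((r ^ k)%:R / t%:R)
    = ((2 * K + 1) ^+ k * t%:R / (r ^ k)%:R)^-1.
  by rewrite !invfM invrK mulrA [RHS]mulrAC.
rewrite lef_pV2 // posrE divr_gt0 ?mulr_gt0 ?ltr0n // expn_gt0 r0 //.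
Qed.

End small_ball.

(** * Recurrence *)

(** Compactness gives finite [1 / (n + 1)]-nets in [C]. Since [C] is closed, it is the intersection
    over [n] of the finite unions of closed balls around these nets, and preimages of such balls are
    measurable. *)
Lemma measurable_preim_compact (R : realType) d (X : measurableType d) (k : nat)
    (h : X -> 'rV[R]_k) (C : set 'rV[R]_k) :
  borel_vec_map h -> compact C -> measurable [set x | C (h x)].
Proof.
move=> mh cC.
have clC : closed C.
  by apply: compact_closed => //; exact: norm_hausdorff.
have cover n : exists D : set 'rV[R]_k, [/\ finite_set D, D `<=` C &
    forall v, C v -> exists2 c, D c & `|v - c| <= n.+1%:R^-1].
  have n0 : (0 : R) < n.+1%:R^-1 by rewrite invr_gt0 ltr0n.
  move: cC; rewrite compact_cover.
  move=> /(_ _ C (fun c => ball c n.+1%:R^-1)) [||D DC Dcov].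
  - by move=> c _; exact: ball_open.
  - by move=> v Cv; exists v => //; exact: ballxx.
  exists [set` D]; split => [|c /DC/set_mem//|v /Dcov[c cD hc]].
    exact: finite_fset.
  exists c => //; move: hc; rewrite -ball_normE /ball_ /= distrC; exact: ltW.
have [D hD] := choice cover.
rewrite (_ : mkset _ = \bigcap_n \bigcup_(c in D n)
    [set x | `|h x - c| <= n.+1%:R^-1]).
  apply: bigcapT_measurable => n; have [fD _ _] := hD n.
  apply: fin_bigcup_measurable => // c _.
  apply: measurable_rV_norm_le => i; under eq_fun do rewrite !mxE.
  exact: measurable_funB.
apply/seteqP; split=> x /=.
  by move=> Cx n _; have [_ _ /(_ _ Cx)[c cD hc]] := hD n; exists c.
move=> hx; apply: clC => A /nbhs_ballP[e /= e0 eA].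
pose n := Num.truncn e^-1.
have [c /= cD hc] := hx n I.
exists c; split; first by have [_ DC _] := hD n; exact: DC.
apply: eA; rewrite -ball_normE /ball_ /=; apply: le_lt_trans hc _.
by rewrite invf_plt ?posrE ?ltr0n // truncnS_gt.
Qed.

Lemma unif_tight_concentrated (R : realType) d (X : measurableType d)
    (mu : probability X R) (T : X -> X) (k : nat) (f : X -> 'rV[R]_k) :
  measurable_fun setT T -> borel_vec_map f -> unif_tight mu T f ->
  exists eps K : R, 0 < eps /\ 0 < K /\
     forall n : nat, (0 < n)%N ->
       (eps%:E < mu [set x | (`| normalized_cocycle T f n x | <= K)%R])%E.
Proof.
move=> mT mf /(_ 2^-1)[|C [cC hC]]; first by rewrite invr_gt0.
have [M [_ hM]] := compact_bounded cC.
(* Tightness at level [1 / 2] leaves mass at least [1 / 2], strictly above [1 / 3]; the radius must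
   be positive and exceed [M] strictly. *)
exists 3^-1, (Num.max M 0 + 1); split; first by rewrite invr_gt0.
split; first by rewrite ltr_pwDr // le_max lexx orbT.
move=> n /hC {}hC; set B := mkset _.
have mC : measurable [set x | C (normalized_cocycle T f n x)].
  exact: measurable_preim_compact (borel_vec_normalized mT mf n) cC.
have mB : measurable B by exact: measurable_rV_norm_le (borel_vec_normalized mT mf n).
have CB : [set x | C (normalized_cocycle T f n x)] `<=` B.
  move=> x /= Cx; apply: (hM (Num.max M 0 + 1)) => //.
  by rewrite (@le_lt_trans _ _ (Num.max M 0)) ?ltrDl // le_max lexx.
move: hC; rewrite (_ : mkset _ = ~` [set x | C (normalized_cocycle T f n x)]) //.
rewrite -[leLHS]fineK ?fin_num_measure //; last exact: measurableC.
rewrite lee_fin fine_probC // => hC.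
have := le_fine_prob mu mC mB CB.
rewrite -[X in (_ < X)%E]fineK ?fin_num_measure // lte_fin; lra.
Qed.

(** * Density of the difference cocycle: zero-one law against small balls *)

Section no_escape.
Context (R : realType) d (X : measurableType d) (mu : probability X R) (k : nat).
Variables (T : X -> X) (f : X -> 'rV[R]_k).
Hypothesis mT : measurable_fun setT T.
Hypothesis pT : forall A, measurable A -> mu (T @^-1` A) = mu A.
Hypothesis ergT : ergodic mu T.
Hypothesis mf : borel_vec_map f.

Let S := swap_pair_map T.
Let g := diff_map f.
Let P : probability (X * X)%type R := (mu \x mu)%E.

Let mS : measurable_fun setT S. Proof. exact: measurable_swap_pair_map. Qed.
Let mg : borel_vec_map g. Proof. exact: borel_vec_diff_map. Qed.
Let pS A : measurable A -> P (S @^-1` A) = P A.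
Proof. exact: swap_pair_map_preserving. Qed.

Lemma density_le_eq_cocycle (g' : X * X -> 'rV[R]_k) lam z z' :
  (forall n, cocycle S g' n z = cocycle S g n z') ->
  density_le S g' lam z -> density_le S g lam z'.
Proof.
move=> e h q; have [rho hrho] := h q; exists rho => r /hrho {}hrho M.
apply: leq_trans (hrho M); rewrite leq_mul2l; apply/orP; right.
by apply: leq_sum => n _; rewrite e ![(_ \in setT)]mem_set.
Qed.

(* Moving one coordinate of [(x, y)] along its orbit changes the difference
   cocycle by a coboundary. *)
Lemma density_le_zero_one lam :
  P [set z | density_le S g lam z] = 0%E \/ P [set z | density_le S g lam z] = 1%E.
Proof.
have mfst : borel_vec_map (fun z : X * X => f z.1).
  by move=> i; exact: (measurableT_comp (mf i) measurable_fst).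
have msnd : borel_vec_map (fun z : X * X => f z.2).
  by move=> i; exact: (measurableT_comp (mf i) measurable_snd).
(* As [V] commutes with [S], the cocycle of [g \o V] is that of [g] started at [V z], so
   [density_le_cohomologous] applies to it. *)
have neg (V : X * X -> X * X) (b : X * X -> 'rV[R]_k) : measurable_fun setT V ->
    borel_vec_map b -> (forall z, S (V z) = V (S z)) ->
    (forall n z, cocycle S g n (V z) = cocycle S g n z - b (iter n S z) + b z) ->
    P.-negligible [set z | density_le S g lam z /\ ~ density_le S g lam (V z)].
  move=> mV mb SV cob.
  have cV n z : cocycle S (g \o V) n z = cocycle S g n (V z).
    apply: eq_bigr => i _ /=; congr g.
    by elim: (i : nat) => [//|j IH] /=; rewrite -SV IH.
  have mgV : borel_vec_map (g \o V) by move=> i; exact: (measurableT_comp (mg i) mV).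
  have := @density_le_cohomologous _ _ _ _ P S mS pS g (g \o V) b mg mgV mb _ lam.
  move=> /(_ (fun n z => etrans (cV n z) (cob n z))).
  apply: negligibleS => z [dz ndz]; split => // dz'; apply: ndz.
  by apply: density_le_eq_cocycle dz' => n; exact: cV.
apply: (product_zero_one mT pT ergT).
- exact: measurable_density_le.
- apply: (neg (fun z => (z.1, T z.2)) (fun z => f z.2)) => //.
    apply: measurable_fun_pair; first exact: measurable_fst.
    exact: (measurableT_comp mT measurable_snd).
  move=> n z; rewrite /S iter_swap_pair_map !cocycle_diff_map /= cocycle_shift.
  by apply/rowP => i; rewrite !mxE; ring.
- apply: (neg (fun z => (T z.1, z.2)) (fun z => - f z.1)) => //.
  + apply: measurable_fun_pair; last exact: measurable_snd.
    exact: (measurableT_comp mT measurable_fst).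
  + move=> i; under eq_fun do rewrite mxE; exact: measurableT_comp (mfst i).
  move=> n z; rewrite /S iter_swap_pair_map !cocycle_diff_map /= cocycle_shift.
  by apply/rowP => i; rewrite !mxE; ring.
Qed.

Let W t r := [set z | `|cocycle S g t z| <= r%:R].

(* The dyadic blocks of times contribute equally, so [J] of them beat any
   bound on the number of visits. *)
Lemma density_le_not_full (c0 : R) (lam : nat) : 0 < c0 ->
  (forall t r, (0 < r)%N -> (r ^ k <= t)%N ->
     c0 * (r ^ k)%:R / t%:R <= fine (P (W t r))) ->
  P [set z | density_le S g lam z] <> 1%E.
Proof.
move=> c00 low full.
have mW t r : measurable (W t r).
  exact: measurable_rV_norm_le (borel_vec_cocycle t mS mg).
(* Egorov-style uniformity: the sets [H rho], with a common threshold, increase to a set of full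
   measure. *)
pose H rho := [set z | forall r, (rho <= r)%N -> forall M,
                 (hits S g setT M r z <= lam.+1 * r ^ k)%N].
have mH rho : measurable (H rho).
  apply: measurable_forall => r; apply: measurable_imply => _.
  apply: measurable_forall => M.
  exact: (@measurable_hits _ _ _ _ S g mS mg setT M r
    [set n | (n <= lam.+1 * r ^ k)%N]).
have ndH : nondecreasing_seq H.
  move=> rho rho' le; apply/subsetPset => z h r rr; apply: h.
  exact: leq_trans le rr.
have UH : fine (P (\bigcup_rho H rho)) = 1.
  apply/eqP; rewrite eq_le; apply/andP; split.
    have -> : 1 = fine (P setT) by rewrite probability_setT.
    by apply: le_fine_prob => //; exact: bigcupT_measurable.
  have -> : 1 = fine (P [set z | density_le S g lam z]) by rewrite full.
  apply: le_fine_prob => //.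
  - exact: measurable_density_le.
  - exact: bigcupT_measurable.
  move=> z /(_ 1%N)[rho h]; exists rho => // r /h {}h M.
  by have := h M; rewrite !mul1n addn1.
pose J := (Num.truncn (4 * lam.+1%:R / c0)).+1.
have hJ : 4 * lam.+1%:R / c0 < J%:R by exact: truncnS_gt.
(* The measure allowed outside [H] is at most half of the lower bound [c0 / 2 ^ (j + 1)] for [W t r]
   in any block [j < J]. *)
have e0 : 0 < c0 / 2 ^+ J.+1 by rewrite divr_gt0 // exprn_gt0.
have [rho0] := fine_prob_bigcup_approx P mH ndH e0; rewrite UH => hrho0.
pose r := maxn rho0 1; pose a := (r ^ k)%N.
have r0 : (0 < r)%N by rewrite leq_max orbT.
have a0 : (0 < a)%N by rewrite expn_gt0 r0.
have aR : (0 : R) < a%:R by rewrite ltr0n.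
have hH : 1 - c0 / 2 ^+ J.+1 < fine (P (H r)).
  apply: lt_le_trans hrho0 _; apply: le_fine_prob => //.
  by move=> z h r' rr'; apply: h; apply: leq_trans rr'; exact: leq_maxl.
have block t j : (j < J)%N -> (2 ^ j * a <= t)%N -> (t < 2 ^ j.+1 * a)%N ->
    c0 / 2 ^+ j.+2 <= fine (P (H r `&` W t r)).
  move=> jJ jt tj.
  have at_ : (a <= t)%N by apply: leq_trans jt; rewrite leq_pmull // expn_gt0.
  have t0 : (0 < t)%N by exact: leq_trans at_.
  have := low t r r0 at_; rewrite -/a => hlow.
  have h1 : c0 / 2 ^+ j.+1 <= c0 * a%:R / t%:R.
    rewrite -mulrA ler_pM2l // ler_pdivlMr ?ltr0n // ler_pdivrMl ?exprn_gt0 //.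
    by rewrite -natrX -natrM ler_nat ltnW.
  have h2 : c0 / 2 ^+ J.+1 <= c0 / 2 ^+ j.+2.
    by rewrite ler_pM2l // lef_pV2 ?posrE ?exprn_gt0 // ler_weXn2l // ler1n.
  have h3 : c0 / 2 ^+ j.+1 = 2 * (c0 / 2 ^+ j.+2).
    by rewrite [in RHS]exprS invfM; field; rewrite expf_neq0.
  have h4 : fine (P (W t r)) <= fine (P (H r `&` W t r)) + (1 - fine (P (H r))).
    have mHW : measurable (H r `&` W t r) by exact: measurableI.
    have mHc : measurable (~` H r) by exact: measurableC.
    rewrite -fine_probC //; apply: fine_prob_le_setU => //.
    by move=> z Wz; have [Hz|nHz] := pselect (H r z); [left|right].
  lra.
have upper : \sum_(t < 2 ^ J * a) fine (P (H r `&` W t r)) <= (lam.+1 * a)%:R.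
  have := @sum_measure_le R _ _ P _ unit (fun t : 'I_(2 ^ J * a) => H r `&` W t r)
    (fun=> setT) 1 (lam.+1 * a).
  rewrite mul1r [\sum_(j : unit) _]big_const card_unit /= addr0 probability_setT mulr1.
  apply => // [t|z]; first exact: measurableI.
  rewrite mul1n [in leqRHS]big_const card_unit /= addn0 mem_set // muln1.
  have [Hz|nHz] := pselect (H r z); last first.
    by rewrite big1 // => t _; apply/eqP; rewrite eqb0; apply/negP => /set_mem[].
  apply: leq_trans (Hz r (leqnn _) (2 ^ J * a)%N).
  apply: leq_sum => t _; rewrite [(_ \in setT)]mem_set //=.
  by have [/set_mem[_ /= ->]|//] := boolP (z \in _).
(* Block [j] has [2 ^ j * a] times, each contributing at least [c0 / 2 ^ (j + 2)], so it adds
   [c0 * a / 4] whatever [j] is. *)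
have lower j : (j <= J)%N ->
    j%:R * (c0 * a%:R / 4) <= \sum_(t < 2 ^ j * a) fine (P (H r `&` W t r)).
  elim: j => [_|j IH jJ].
    by rewrite mul0r sumr_ge0 // => t _; exact: fine_prob_ge0.
  have {}IH := IH (ltnW jJ).
  rewrite -(big_mkord predT (fun t => fine (P (H r `&` W t r)))).
  rewrite (@big_cat_nat _ _ _ (2 ^ j * a)) //=; last by rewrite leq_mul2r leq_exp2l ?leqnSn ?orbT.
  rewrite big_mkord -natr1 mulrDl mul1r; apply: lerD => //.
  have -> : c0 * a%:R / 4 = \sum_(2 ^ j * a <= t < 2 ^ j.+1 * a) (c0 / 2 ^+ j.+2).
    rewrite big_const_nat iter_addr_0 expnS -mulnA mul2n -addnn addnK.
    rewrite -[RHS]mulr_natr natrM natrX !exprS.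
    by field; rewrite expf_neq0.
  by apply: ler_sum_nat => t /andP[h1 h2]; exact: block.
have := le_trans (lower J (leqnn _)) upper.
rewrite leNgt => /negP; apply.
move: hJ; rewrite ltr_pdivrMr // natrM => hJ.
have -> : J%:R * (c0 * a%:R / 4) = (J%:R * c0 / 4) * a%:R by field.
rewrite ltr_pM2r //; lra.
Qed.

End no_escape.

Lemma limn_einf_eq0 (R : realType) (u : nat -> R) : (forall n, 0 <= u n) ->
  (forall n0 c, exists2 n, (n0 <= n)%N & u n <= (c.+1%:R)^-1) ->
  limn_einf (fun n => (u n)%:E) = 0%E.
Proof.
move=> u0 small; rewrite limn_einf_lim.
suff -> : einfs (fun n => (u n)%:E) = cst 0%E by exact: lim_cst.
apply/funext => n /=; apply/eqP; rewrite eq_le; apply/andP; split; last first.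
  by apply: le_ereal_inf_tmp => _ [m _ <-]; rewrite lee_fin.
apply/lee_addgt0Pr => e e0; rewrite add0e.
have [m nm hm] := small n (Num.truncn e^-1).
apply: (@le_trans _ _ (u m)%:E); first by apply: ereal_inf_lbound; exists m.
rewrite lee_fin; apply: le_trans hm _; apply: ltW.
by rewrite invf_plt ?posrE ?ltr0n // truncnS_gt.
Qed.

Theorem theorem14 (R : realType) (dX : measure_display) (X : measurableType dX)
    (mu : probability X R) (T : X -> X) (d : nat) (f : X -> 'rV[R]_d) :
  standard_borel R X ->
  mp_automorphism mu T ->
  ergodic mu T ->
  (0 < d)%N ->
  borel_vec_map f ->
  (unif_tight mu T f \/
   exists eps K : R, 0 < eps /\ 0 < K /\
     forall n : nat, (0 < n)%N ->
       (eps%:E < mu [set x | (`| normalized_cocycle T f n x | <= K)%R])%E) ->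
  recurrent (mu \x mu)%E (swap_pair_map T) (diff_map f).
Proof.
move=> _ [_ [_ [_ [mT [_ pT]]]]] ergT d0 mf conc.
have {conc}[eps [K [e0 [K0 conc]]]] : exists eps K : R, 0 < eps /\ 0 < K /\
     forall n : nat, (0 < n)%N ->
       (eps%:E < mu [set x | (`| normalized_cocycle T f n x | <= K)%R])%E.
  by case: conc => // ?; exact: unif_tight_concentrated.
pose S := swap_pair_map T; pose g := diff_map f.
have mS : measurable_fun setT S by exact: measurable_swap_pair_map.
have mg : borel_vec_map g by exact: borel_vec_diff_map.
(* Nonrecurrent points lie in the countable union of these sets, so it suffices that each is
   null. *)
pose E n0 c := [set z | forall n, (n0 <= n)%N ->
                  ~ (`|cocycle S g n z| <= (c.+1%:R)^-1)].
have mE n0 c : measurable (E n0 c).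
  apply: measurable_forall => n; apply: measurable_imply => _.
  apply: measurableC; exact: measurable_rV_norm_le (borel_vec_cocycle n mS mg).
have E0 n0 c : (mu \x mu)%E (E n0 c) = 0%E.
  apply: (@prob0_fine _ _ _ (mu \x mu)%E) => //.
  apply/eqP; rewrite eq_le fine_prob_ge0 andbT leNgt; apply/negP => Epos.
  have pS := swap_pair_map_preserving mT pT.
  have [lam lampos] := density_le_pos (P := (mu \x mu)%E) mS pS mg (mE n0 c)
    (@sparse_escape _ _ _ S g n0 c) Epos.
  have c00 : 0 < eps ^+ 2 / (2 * K + 1) ^+ d.
    by rewrite divr_gt0 ?exprn_gt0 // addr_gt0 // mulr_gt0.
  (* Measure zero contradicts [lampos]; full measure contradicts the small ball estimate. *)
  have [h0|] := density_le_zero_one mT pT ergT mf lam.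
    by move: lampos; rewrite h0 ltxx.
  apply: (density_le_not_full mT mf c00) => t r r0 rt.
  apply: small_ball_lower => //; apply: conc.
  by apply: leq_trans rt; rewrite expn_gt0 r0.
have : (mu \x mu)%E.-negligible (\bigcup_n0 \bigcup_c E n0 c).
  do 2 apply: negligible_bigcup => ?; apply/negligibleP; [exact: mE|exact: E0].
apply: negligibleS => z /= nz; apply: contrapT => nE; apply: nz.
apply: limn_einf_eq0 => [n|n0 c]; first exact: normr_ge0.
apply: contrapT => h; apply: nE; exists n0 => //; exists c => // n n0n hn.
by apply: h; exists n.
Qed.
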